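(* Let $\Lambda$ be a Noetherian associative commutative unitary ring, let $N$ and $M$ be finitely generated $\Lambda$-modules, and let $f:N\times N\to M$ be a full and non-degenerate $\Lambda$-bilinear map. Then both $Z(\mathrm{Sym}(f))$ and the largest ring of scalars $R(f)$ of $f$ are e-interpretable (as $\Lambda$-algebras, i.e. in the language $\mathcal{L}_{\mathrm{alg}}$) in the two-sorted structure $(N,M;f,\mathcal{L}_{\mathrm{mod}})$.
   Context: $f$ is non-degenerate if $f(a,x)=0$ for all $x\in N$ implies $a=0$, and $f(x,a)=0$ for all $x\in N$ implies $a=0$; $f$ is full if the image of $f$ generates $M$ as a $\Lambda$-module. $\mathrm{End}_\Lambda(N)$ is the $\Lambda$-algebra of module endomorphisms of $N$ (multiplication is composition). Define $$\mathrm{Sym}(f)=\{\alpha\in \mathrm{End}_\Lambda(N)\mid f(\alpha x,y)=f(x,\alpha y)\ \text{for all}\ x,y\in N\},$$ $$Z(\mathrm{Sym}(f))=\{\alpha\in\mathrm{Sym}(f)\mid\alpha\beta=\beta\alpha\ \text{for all}\ \beta\in\mathrm{Sym}(f)\};$$ the latter is a $\Lambda$-subalgebra of $\mathrm{End}_\Lambda(N)$. A ring of scalars of $f$ is an associative commutative unitary ring $\Delta$ with faithful actions on $N$ and $M$ by $\Lambda$-endomorphisms (i.e. ring embeddings $\Delta\hookrightarrow\mathrm{End}_\Lambda(N)$, $\Delta\hookrightarrow\mathrm{End}_\Lambda(M)$) such that $f(\alpha x,y)=f(x,\alpha y)=\alpha f(x,y)$ for all $\alpha\in\Delta$, $x,y\in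 N$; it is regarded as a subring of $\mathrm{End}_\Lambda(N)$. The largest ring of scalars $R(f)$ is the one containing every other ring of scalars as subrings of $\mathrm{End}_\Lambda(N)$ (it exists and is unique for $f$ full and non-degenerate, and is a $\Lambda$-algebra). Languages: $\mathcal{L}_{\mathrm{mod}}=(+,\{\cdot_\lambda\mid\lambda\in\Lambda\})$, $\mathcal{L}_{\mathrm{alg}}=(+,\cdot,\{\cdot_\lambda\mid\lambda\in\Lambda\})$, where $\cdot_\lambda$ is the unary function $x\mapsto\lambda x$. $(N,M;f,\mathcal{L}_{\mathrm{mod}})$ is the two-sorted structure with sorts $N$ and $M$, their $\Lambda$-module operations, and the function $f$. A system of equations in a structure $\mathcal{M}$ is a finite conjunction of atomic formulas (equality on each sort is always a relation) in which any elements of $\mathcal{M}$ may be used as constants. A basic set of $\mathcal{M}$ is a finite Cartesian product of sorts. A subset $X$ of a basic set $B$ is e-definable in $\mathcal{M}$ if there is a system of equations $\Sigma(\mathbf{x},\mathbf{y})$ such that for all $\mathbf{a}\in B$: $\mathbf{a}\in X$ iff $\Sigma(\mathbf{a},\mathbf{y})$ has a solution $\mathbf{y}$ in $\mathcal{M}$. A structure $\mathcal{A}$ with sorts $A_i$ is e-interpretable in $\mathcal{M}$ if for each $i$ there are an e-definable subset $X_i$ of a basic set of $\mathcal{M}$ and a surjective map $\phi_i:X_i\to A_i$ such that for each function and relation in the signature of $\mathcal{A}$ (including equality on each sort), the preimage of its graph under $(\phi_i)_i$ is e-definable in $\mathcal{M}$. *)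

(* Defs.v *)
From HB Require Import structures.
From mathcomp Require Import all_boot all_algebra.
From mathcomp Require Import boolp classical_sets.

Set Implicit Arguments.
Unset Strict Implicit.
Unset Printing Implicit Defensive.

Import GRing.Theory.
Local Open Scope classical_set_scope.
Local Open Scope ring_scope.

Record signature := Signature {
  sig_sort : Type;
  sig_fun : Type;
  fun_arity : sig_fun -> nat;
  fun_dom : forall g : sig_fun, 'I_(fun_arity g) -> sig_sort;
  fun_cod : sig_fun -> sig_sort;
  sig_rel : Type;
  rel_arity : sig_rel -> nat;
  rel_dom : forall r : sig_rel, 'I_(rel_arity r) -> sig_sort
}.

Arguments fun_dom {s} g j.
Arguments rel_dom {s} r j.

Record structure (S : signature) := Structure {
  carrier :> sig_sort S -> Type;
  fun_interp : forall g : sig_fun S,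
    (forall j, carrier (fun_dom g j)) -> carrier (fun_cod g);
  rel_interp : forall r : sig_rel S, (forall j, carrier (rel_dom r j)) -> Prop
}.

(* The basic set (finite product of sorts) given by a finite family s of sorts;
   it is also the set of valuations of a tuple of variables of sorts s. *)
Definition basic_set (S : signature) (A : structure S) (I : finType)
  (s : I -> sig_sort S) : Type := forall i, A (s i).

Definition cat_sorts (T : Type) (I J : finType) (s : I -> T) (t : J -> T)
  (k : I + J) : T := match k with inl i => s i | inr j => t j end.

Definition cat_tuple (S : signature) (A : structure S) (I J : finType)
    (s : I -> sig_sort S) (t : J -> sig_sort S)
    (a : basic_set A s) (b : basic_set A t) : basic_set A (cat_sorts s t) :=
  fun k => match k with inl i => a i | inr j => b j end.

Inductive term (S : signature) (A : structure S) (I : finType)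
    (s : I -> sig_sort S) : sig_sort S -> Type :=
| TVar (i : I) : term A s (s i)
| TConst (u : sig_sort S) (a : A u) : term A s u
| TApp (g : sig_fun S) (t : forall j, term A s (fun_dom g j)) :
    term A s (fun_cod g).

Inductive atomic (S : signature) (A : structure S) (I : finType)
    (s : I -> sig_sort S) : Type :=
| AEq (u : sig_sort S) (t1 t2 : term A s u)
| ARel (r : sig_rel S) (t : forall j, term A s (rel_dom r j)).

Fixpoint eval (S : signature) (A : structure S) (I : finType)
    (s : I -> sig_sort S) (v : basic_set A s) (u : sig_sort S)
    (t : term A s u) : A u :=
  match t in term _ _ u return A u with
  | TVar i => v i
  | TConst _ a => a
  | TApp g t => fun_interp (fun j => eval v (t j))
  end.

Definition holds (S : signature) (A : structure S) (I : finType)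
    (s : I -> sig_sort S) (v : basic_set A s) (p : atomic A s) : Prop :=
  match p with
  | AEq _ t1 t2 => eval v t1 = eval v t2
  | ARel r t => rel_interp (fun j => eval v (t j))
  end.

Definition solves (S : signature) (A : structure S) (I : finType)
    (s : I -> sig_sort S) (v : basic_set A s) (E : seq (atomic A s)) : Prop :=
  foldr (fun p P => holds v p /\ P) True E.

Definition e_definable (S : signature) (A : structure S) (I : finType)
    (s : I -> sig_sort S) (X : set (basic_set A s)) : Prop :=
  exists (J : finType) (t : J -> sig_sort S)
         (E : seq (atomic A (cat_sorts s t))),
    forall a, X a <-> exists y : basic_set A t, solves (cat_tuple a y) E.

(* Given phi u : X u -> A u, with X u a subset of the basic set of B of
   sorts s u, and a set P of tuples of A indexed by K, of sorts r, the preimage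
   of P lives in the product over k : K of the basic sets of sorts s (r k),
   which is the basic set of B indexed by {k : K & I (r k)}. *)
Definition preimage_sorts (S T : signature) (I : sig_sort S -> finType)
    (s : forall u, I u -> sig_sort T) (K : finType) (r : K -> sig_sort S)
    (p : {k : K & I (r k)}) : sig_sort T := s (r (tag p)) (tagged p).

Definition tuple_preimage (S T : signature) (A : structure S)
    (B : structure T) (I : sig_sort S -> finType)
    (s : forall u, I u -> sig_sort T)
    (X : forall u, set (basic_set B (s u)))
    (phi : forall u, {x | X u x} -> A u)
    (K : finType) (r : K -> sig_sort S) (P : set (basic_set A r)) :
    set (basic_set B (preimage_sorts s (r := r))) :=
  fun x =>
    exists hx : forall k, X (r k) (fun i => x (existT (fun k => I (r k)) k i)),
      P (fun k => phi (r k) (exist _ _ (hx k))).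

Definition equality_graph (S : signature) (A : structure S) (u : sig_sort S) :
    set (basic_set A (fun _ : bool => u)) :=
  fun a => a true = a false.

(* The arguments are at the indices Some j and the value is at None. *)
Definition graph_sorts (S : signature) (g : sig_fun S)
    (k : option 'I_(fun_arity g)) : sig_sort S :=
  match k with Some j => fun_dom g j | None => fun_cod g end.

Definition function_graph (S : signature) (A : structure S) (g : sig_fun S) :
    set (basic_set A (graph_sorts (g := g))) :=
  fun a => fun_interp (fun j => a (Some j)) = a None.

Definition e_interpretable (S T : signature) (A : structure S)
    (B : structure T) : Prop :=
  exists (I : sig_sort S -> finType) (s : forall u, I u -> sig_sort T)
         (X : forall u, set (basic_set B (s u)))
         (phi : forall u, {x | X u x} -> A u),
  [/\ forall u, e_definable (X u),
      forall u (a : A u), exists x, phi u x = a,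
      forall u, e_definable (tuple_preimage phi (@equality_graph S A u)),
      forall g, e_definable (tuple_preimage phi (@function_graph S A g)) &
      forall r, e_definable (tuple_preimage phi (@rel_interp S A r))].

Definition lspan (L : pzRingType) (V : lmodType L) (G : set V) : set V :=
  [set v | exists (n : nat) (c : 'I_n -> L) (g : 'I_n -> V),
     (forall i, G (g i)) /\ v = \sum_(i < n) c i *: g i].

Definition finitely_generated (L : pzRingType) (V : lmodType L) : Prop :=
  exists s : seq V, lspan [set x | x \in s] = setT.

Definition ideal (L : comPzRingType) (a : set L) : Prop :=
  [/\ a 0, forall x y, a x -> a y -> a (x + y) &
      forall c x, a x -> a (c * x)].

Definition noetherian (L : comPzRingType) : Prop :=
  forall a : set L, ideal a ->
    exists s : seq L, @lspan L L^o [set x | x \in s] = a.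

(* The library's {bilinear _ -> _ -> _} is this condition, but it is available
   over nonzero rings only. *)
Definition is_bilinear (L : comPzRingType) (N M : lmodType L)
    (f : N -> N -> M) : Prop :=
  (forall y, linear (f^~ y)) /\ (forall x, linear (f x)).

Definition bimap_full (L : comPzRingType) (N M : lmodType L)
    (f : N -> N -> M) : Prop :=
  lspan [set m | exists x y, m = f x y] = setT.

Definition bimap_nondegenerate (L : comPzRingType) (N M : lmodType L)
    (f : N -> N -> M) : Prop :=
  (forall a, (forall x, f a x = 0) -> a = 0) /\
  (forall a, (forall x, f x a = 0) -> a = 0).

Definition Sym (L : comPzRingType) (N M : lmodType L) (f : N -> N -> M) :
    set {linear N -> N} :=
  [set a | forall x y, f (a x) y = f x (a y)].

Definition ZSym (L : comPzRingType) (N M : lmodType L) (f : N -> N -> M) :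
    set {linear N -> N} :=
  [set a | Sym f a /\ forall b, Sym f b -> a \o b =1 b \o a].

Record ring_embedding (L : comPzRingType) (V : lmodType L)
    (D : comPzRingType) (h : D -> {linear V -> V}) : Prop := RingEmbedding {
  ring_embedding_inj : injective h;
  ring_embeddingD : forall a b, h (a + b) =1 h a \+ h b;
  ring_embeddingM : forall a b, h (a * b) =1 h a \o h b;
  ring_embedding1 : h 1 =1 id
}.

(* R is (the image in End(N) of) a ring of scalars of f. *)
Definition ring_of_scalars (L : comPzRingType) (N M : lmodType L)
    (f : N -> N -> M) (R : set {linear N -> N}) : Prop :=
  exists (D : comPzRingType) (hN : D -> {linear N -> N})
         (hM : D -> {linear M -> M}),
  [/\ ring_embedding hN, ring_embedding hM,
      forall a x y, f (hN a x) y = f x (hN a y) /\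
                    f x (hN a y) = hM a (f x y) &
      R = range hN].

Definition largest_ring_of_scalars (L : comPzRingType) (N M : lmodType L)
    (f : N -> N -> M) (R : set {linear N -> N}) : Prop :=
  ring_of_scalars f R /\ forall R', ring_of_scalars f R' -> R' `<=` R.

Record is_subalgebra (L : comPzRingType) (V : lmodType L)
    (R : set {linear V -> V}) : Prop := IsSubalgebra {
  subalgebra1 : R idfun;
  subalgebraD : forall a b, R a -> R b -> R (a \+ b);
  subalgebraM : forall a b, R a -> R b -> R (a \o b);
  subalgebraZ : forall c a, R a -> R (c \*: a)
}.

Section BilinearTheory.
Variables (L : comPzRingType) (N M : lmodType L) (f : N -> N -> M).
Hypothesis bf : is_bilinear f.

Lemma bilin_Dl x x' y : f (x + x') y = f x y + f x' y.
Proof. by have := bf.1 y 1 x x'; rewrite !scale1r. Qed.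

Lemma bilin_Dr x y y' : f x (y + y') = f x y + f x y'.
Proof. by have := bf.2 x 1 y y'; rewrite !scale1r. Qed.

Lemma bilin_0l y : f 0 y = 0.
Proof. by apply: (addrI (f 0 y)); rewrite -bilin_Dl !addr0. Qed.

Lemma bilin_0r x : f x 0 = 0.
Proof. by apply: (addrI (f x 0)); rewrite -bilin_Dr !addr0. Qed.

Lemma bilin_Zl c x y : f (c *: x) y = c *: f x y.
Proof. by have := bf.1 y c x 0; rewrite bilin_0l !addr0. Qed.

Lemma bilin_Zr c x y : f x (c *: y) = c *: f x y.
Proof. by have := bf.2 x c y 0; rewrite bilin_0r !addr0. Qed.

Lemma bilin_Bl x x' y : f (x - x') y = f x y - f x' y.
Proof. by rewrite bilin_Dl -scaleN1r bilin_Zl scaleN1r. Qed.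

Lemma ZSym_subalgebra : is_subalgebra (ZSym f).
Proof.
split.
- by split.
- move=> a b [sa ca] [sb cb]; split=> [x y /=|g sg x /=].
    by rewrite bilin_Dl bilin_Dr sa sb.
  by rewrite linearD; congr (_ + _); [apply: ca | apply: cb].
- move=> a b [sa ca] [sb cb]; split=> [x y /=|g sg x /=].
    by rewrite sa sb; congr (f x _); symmetry; apply: ca.
  by rewrite -[g (a (b x))](ca g sg); congr (a _); apply: cb.
- move=> c a [sa ca]; split=> [x y /=|g sg x /=].
    by rewrite bilin_Zl bilin_Zr sa.
  by rewrite linearZ; congr (_ *: _); apply: ca.
Qed.

End BilinearTheory.

Lemma linear_ext (L : pzRingType) (U V : lmodType L) (g h : {linear U -> V}) :
  g =1 h -> g = h.
Proof.
case: g h => g cg [h ch] /= gh.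
have {}gh : g = h by apply: funext.
subst h; congr (GRing.Linear.Pack _).
case: cg ch => [[p] [q]] [[p'] [q']].
by rewrite (Prop_irrelevance p p') (Prop_irrelevance q q').
Qed.

Section LargestRing.
Variables (L : comPzRingType) (N M : lmodType L) (f : N -> N -> M).
Hypotheses (bf : is_bilinear f) (ff : bimap_full f).
Hypothesis nf : bimap_nondegenerate f.

Let scalar_pair (a : {linear N -> N}) (b : {linear M -> M}) :=
  forall x y, f (a x) y = f x (a y) /\ f x (a y) = b (f x y).

Let all_scalars : set {linear N -> N} := [set a | exists b, scalar_pair a b].

Let endo_inj (a a' : {linear N -> N}) :
  (forall x y, f (a x) y = f (a' x) y) -> a = a'.
Proof.
move=> h; apply: linear_ext => x; apply/eqP; rewrite -subr_eq0; apply/eqP.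
by apply: nf.1 => y; rewrite bilin_Bl // h subrr.
Qed.

Let endoM_inj (b b' : {linear M -> M}) :
  (forall x y, b (f x y) = b' (f x y)) -> b = b'.
Proof.
move=> h; apply: linear_ext => m.
have : lspan [set m | exists x y, m = f x y] m by rewrite ff.
move=> [n [c [g [gf ->]]]]; rewrite !linear_sum; apply: eq_bigr => i _.
by rewrite !linearZ; have [x [y ->]] := gf i; rewrite h.
Qed.

Let all_scalarsP : is_subalgebra all_scalars.
Proof.
split.
- by exists idfun.
- move=> a a' [b h] [b' h']; exists (b \+ b') => x y /=.
  rewrite bilin_Dl // bilin_Dr //.
  by rewrite (h x y).1 (h' x y).1 (h x y).2 (h' x y).2.
- move=> a a' [b h] [b' h']; exists (b \o b') => x y /=.
  rewrite (h _ y).1 (h _ y).2 (h' x y).1 (h' x y).2.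
  by rewrite (h x (a' y)).2 (h' x y).2.
- move=> c a [b h]; exists (c \*: b) => x y /=.
  by rewrite bilin_Zl // bilin_Zr // (h x y).1 (h x y).2.
Qed.

Let all_scalars_ring : ring_of_scalars f all_scalars.
Proof.
have [S1 SD SM SZ] := all_scalarsP.
pose D := {a | all_scalars a}.
pose eD : hasDecEq D := gen_eqMixin D.
pose cD : hasChoice D := gen_choiceMixin D.
have Deq (u v : D) : (forall x, sval u x = sval v x) -> u = v.
  by case: u v => u hu [v hv] uv; apply: eq_exist; exact: linear_ext.
have S0 : all_scalars \0.
  have -> : \0 = 0 \*: idfun :> {linear N -> N}.
    by apply: linear_ext => x /=; rewrite scale0r.
  exact: SZ.
pose z : D := exist _ _ S0.
pose o : D := exist _ _ S1.
pose ad (u v : D) : D := exist _ _ (SD _ _ (svalP u) (svalP v)).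
pose mu (u v : D) : D := exist _ _ (SM _ _ (svalP u) (svalP v)).
pose op (u : D) : D := exist _ _ (SZ (-1) _ (svalP u)).
have adA : associative ad by move=> u v w; apply: Deq => x /=; rewrite addrA.
have adC : commutative ad by move=> u v; apply: Deq => x /=; rewrite addrC.
have ad0 : left_id z ad by move=> u; apply: Deq => x /=; rewrite add0r.
have adN : left_inverse z op ad.
  by move=> u; apply: Deq => x /=; rewrite scaleN1r addNr.
have muA : associative mu by move=> u v w; apply: Deq.
have muC : commutative mu.
  move=> [a [b h]] [a' [b' h']]; apply: eq_exist; apply: endo_inj => x y /=.
  rewrite (h _ y).1 (h' x (a y)).1.
  by rewrite (h' x (a y)).2 (h' _ y).1 (h' _ y).2 (h x y).1.
have mu1 : left_id o mu by move=> u; apply: Deq.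
have muD : left_distributive mu ad by move=> u v w; apply: Deq.
pose cT : choiceType := HB.pack D eD cD.
pose zD := GRing.isZmodule.Build cT adA adC ad0 adN.
pose zT : zmodType := HB.pack D cT zD.
pose rD := GRing.Zmodule_isComPzRing.Build zT muA muC mu1 muD.
pose rT : comPzRingType := HB.pack D zT rD.
pose hM (u : rT) : {linear M -> M} := sval (cid (svalP (u : D))).
have hMP (u : rT) : scalar_pair (sval (u : D)) (hM u).
  exact: (svalP (cid (svalP (u : D)))).
exists rT, (fun u : rT => sval (u : D)), hM; split.
- split=> //.
  by move=> u v uv; apply: Deq => x; rewrite uv.
- split.
  + move=> u v uv; apply: Deq => t.
    suff -> : sval (u : D) = sval (v : D) by [].
    apply: endo_inj => x y.
    by rewrite (hMP u x y).1 (hMP u x y).2 uv -(hMP v x y).2 -(hMP v x y).1.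
  + move=> u v m; pose b := [the {linear M -> M} of hM u \+ hM v].
    suff -> : hM (u + v) = b by [].
    apply: endoM_inj => x y /=; rewrite -!(hMP _ x y).2 /=.
    by rewrite bilin_Dr.
  + move=> u v m; pose b := [the {linear M -> M} of hM u \o hM v].
    suff -> : hM (u * v) = b by [].
    apply: endoM_inj => x y /=; rewrite -!(hMP _ x y).2 /=.
    by rewrite -(hMP _ _ _).2.
  + move=> m; suff -> : hM 1 = idfun by [].
    by apply: endoM_inj => x y /=; rewrite -(hMP _ x y).2.
- exact: hMP.
- apply/seteqP; split=> [a ha|_ [u _ <-]]; last exact: svalP.
  by exists (exist _ a ha).
Qed.

Let sub_all_scalars (R : set {linear N -> N}) :
  ring_of_scalars f R -> R `<=` all_scalars.
Proof.
move=> [D [hN [hM [_ _ hf ->]]]] _ [u _ <-]; exists (hM u); exact: hf.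
Qed.

Lemma largest_ring_of_scalars_exists :
  exists R, largest_ring_of_scalars f R.
Proof. by exists all_scalars; split=> // R; exact: sub_all_scalars. Qed.

Lemma largest_ring_of_scalars_unique (R R' : set {linear N -> N}) :
  largest_ring_of_scalars f R -> largest_ring_of_scalars f R' -> R = R'.
Proof.
by move=> [sR mR] [sR' mR']; apply/seteqP; split; [exact: mR'|exact: mR].
Qed.

Lemma largest_ring_of_scalars_subalgebra (R : set {linear N -> N}) :
  largest_ring_of_scalars f R -> is_subalgebra R.
Proof.
move=> [sR mR]; suff -> : R = all_scalars by exact: all_scalarsP.
by apply/seteqP; split; [exact: sub_all_scalars|exact: mR].
Qed.

End LargestRing.

(* Below, the scalars c : L are unary function symbols; ord0 is the index of the
   first argument and ord_max that of the last one. *)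

Inductive alg_fun (L : Type) : Type := AlgAdd | AlgMul | AlgScale of L.
Arguments AlgAdd {L}.
Arguments AlgMul {L}.

Definition alg_signature (L : Type) : signature :=
  {| sig_sort := unit;
     sig_fun := alg_fun L;
     fun_arity := fun g => match g with AlgAdd | AlgMul => 2 | AlgScale _ => 1 end;
     fun_dom := fun _ _ => tt;
     fun_cod := fun _ => tt;
     sig_rel := void;
     rel_arity := fun _ => 0;
     rel_dom := fun _ _ => tt |}.

Section SubalgebraStructure.
Variables (L : comPzRingType) (V : lmodType L) (R : set {linear V -> V}).
Hypothesis hR : is_subalgebra R.

Let car := {a : {linear V -> V} | R a}.

Definition subalg_add (a b : car) : car :=
  exist _ _ (subalgebraD hR (svalP a) (svalP b)).
Definition subalg_mul (a b : car) : car :=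
  exist _ _ (subalgebraM hR (svalP a) (svalP b)).
Definition subalg_scale (c : L) (a : car) : car :=
  exist _ _ (subalgebraZ hR c (svalP a)).

Definition subalgebra_structure : structure (alg_signature L) :=
  @Structure (alg_signature L) (fun _ => car)
    (fun g => match g with
       | AlgAdd => fun a => subalg_add (a ord0) (a ord_max)
       | AlgMul => fun a => subalg_mul (a ord0) (a ord_max)
       | AlgScale c => fun a => subalg_scale c (a ord0)
       end)
    (fun r => match r with end).

End SubalgebraStructure.

Inductive bimap_sort : Type := SortN | SortM.

Inductive bimap_fun (L : Type) : Type :=
| ModAdd of bimap_sort
| ModScale of bimap_sort & L
| BimapApp.
Arguments ModAdd {L}.
Arguments BimapApp {L}.

Definition bimap_signature (L : Type) : signature :=
  {| sig_sort := bimap_sort;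
     sig_fun := bimap_fun L;
     fun_arity := fun g =>
       match g with ModAdd _ | BimapApp => 2 | ModScale _ _ => 1 end;
     fun_dom := fun g _ =>
       match g with ModAdd s | ModScale s _ => s | BimapApp => SortN end;
     fun_cod := fun g =>
       match g with ModAdd s | ModScale s _ => s | BimapApp => SortM end;
     sig_rel := void;
     rel_arity := fun _ => 0;
     rel_dom := fun _ _ => SortN |}.

Definition bimap_carrier (L : pzRingType) (N M : lmodType L) (s : bimap_sort) :
    lmodType L :=
  match s with SortN => N | SortM => M end.

Definition bimap_structure (L : comPzRingType) (N M : lmodType L)
    (f : N -> N -> M) : structure (bimap_signature L) :=
  @Structure (bimap_signature L) (fun s => bimap_carrier N M s)
    (fun g => match g with
       | ModAdd s => fun a => (a ord0 : bimap_carrier N M s) + a ord_max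
       | ModScale s c => fun a => c *: (a ord0 : bimap_carrier N M s)
       | BimapApp => fun a => f (a ord0) (a ord_max)
       end)
    (fun r => match r with end).

(* Main.v *)
(* Fix generators n_1, ..., n_k of N and represent an endomorphism a by the tuple
   (a n_1, ..., a n_k). By nondegeneracy, the tuples of symmetric endomorphisms
   are exactly the solutions of f(a_i, n_j) = f(n_i, a_j), and for symmetric a, b
   the product c = ab is given by f(c_i, n_j) = f(b_i, a_j). Commuting with every
   b in Sym(f) is a family of equations depending linearly on the matrix of b;
   these matrices form a submodule of the k x k matrices over L, so by
   Noetherianity finitely many equations suffice. Likewise, multiplication by a
   descends to M if and only if sum C_ij f(n_i, a_j) = 0 for each matrix C of
   the submodule defined by sum C_ij f(n_i, n_j) = 0. *)
From HB Require Import structures.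
Require Import Defs.
From mathcomp Require Import all_boot all_algebra.
From mathcomp Require Import boolp classical_sets.

Set Implicit Arguments.
Unset Strict Implicit.
Unset Printing Implicit Defensive.

Import GRing.Theory.
Local Open Scope classical_set_scope.
Local Open Scope ring_scope.

(** * Solution sets of finite systems of equations *)

Section EquationDefinable.
Variables (S : signature) (A : structure S).

Fixpoint subst (I J : finType) (s : I -> sig_sort S) (t : J -> sig_sort S)
    (th : forall i, term A t (s i)) u (p : term A s u) : term A t u :=
  match p in term _ _ u return term A t u with
  | TVar i => th i
  | TConst _ a => TConst t a
  | TApp g q => TApp (fun j => subst th (q j))
  end.

Definition atomic_subst (I J : finType) (s : I -> sig_sort S)
    (t : J -> sig_sort S) (th : forall i, term A t (s i)) (p : atomic A s) :
    atomic A t :=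
  match p with
  | AEq _ p1 p2 => AEq (subst th p1) (subst th p2)
  | ARel r q => ARel (fun j => subst th (q j))
  end.

Lemma eval_subst (I J : finType) (s : I -> sig_sort S) (t : J -> sig_sort S)
    (th : forall i, term A t (s i)) u (p : term A s u) (v : basic_set A t) :
  eval v (subst th p) = eval (fun i => eval v (th i)) p.
Proof.
elim: p => //= g q IH; congr (fun_interp _).
by apply: functional_extensionality_dep => j; exact: IH.
Qed.

Lemma holds_subst (I J : finType) (s : I -> sig_sort S) (t : J -> sig_sort S)
    (th : forall i, term A t (s i)) (p : atomic A s) (v : basic_set A t) :
  holds v (atomic_subst th p) <-> holds (fun i => eval v (th i)) p.
Proof.
case: p => [u p1 p2|r q] /=; first by rewrite !eval_subst.
suff -> : (fun j => eval v (subst th (q j))) =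
  (fun j => eval (fun i => eval v (th i)) (q j)) by [].
by apply: functional_extensionality_dep => j; rewrite eval_subst.
Qed.

Lemma solves_cat (I : finType) (s : I -> sig_sort S) (E F : seq (atomic A s))
    (v : basic_set A s) :
  solves v (E ++ F) <-> solves v E /\ solves v F.
Proof.
elim: E => [|p E IH] /=; first by split=> [?|[]].
by rewrite /solves /= -!/(solves _ _) IH; split=> [[? []]|[[]]].
Qed.

(** A strengthening of [e_definable] without auxiliary unknowns. Conjunctions then amount to
    concatenating systems, with no unknowns to keep apart, and every set in the interpretation turns
    out to be of this kind. *)
Definition eq_definable (I : finType) (s : I -> sig_sort S)
    (X : set (basic_set A s)) : Prop :=
  exists E : seq (atomic A s), forall a, X a <-> solves a E.

Lemma eq_definable_ext (I : finType) (s : I -> sig_sort S)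
    (X Y : set (basic_set A s)) :
  (forall a, X a <-> Y a) -> eq_definable Y -> eq_definable X.
Proof. by move=> XY [E hE]; exists E => a; rewrite XY. Qed.

Lemma eq_definableI (I : finType) (s : I -> sig_sort S)
    (X Y : set (basic_set A s)) :
  eq_definable X -> eq_definable Y -> eq_definable (X `&` Y).
Proof.
move=> [E hE] [F hF]; exists (E ++ F) => a.
by rewrite solves_cat -hE -hF.
Qed.

Lemma eq_definable_seq (I : finType) (s : I -> sig_sort S) (K : eqType)
    (r : seq K) (X : K -> set (basic_set A s)) :
  (forall k, k \in r -> eq_definable (X k)) ->
  eq_definable [set a | forall k, k \in r -> X k a].
Proof.
elim: r => [|k r IH] hX; first by exists [::] => a; split.
apply: (@eq_definable_ext _ _ _ (X k `&` [set a | forall l, l \in r -> X l a])).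
  move=> a; split=> [h|[h h'] l].
    by split=> [|l lr]; apply: h; rewrite inE ?eqxx ?lr ?orbT.
  by rewrite inE => /predU1P[->|/h'].
apply: eq_definableI; first by apply: hX; rewrite inE eqxx.
by apply: IH => l lr; apply: hX; rewrite inE lr orbT.
Qed.

Lemma eq_definable_forall (I : finType) (s : I -> sig_sort S) (K : finType)
    (X : K -> set (basic_set A s)) :
  (forall k, eq_definable (X k)) -> eq_definable [set a | forall k, X k a].
Proof.
move=> hX; have := @eq_definable_seq _ _ _ (enum K) X (fun k _ => hX k).
apply: eq_definable_ext => a; split=> h k; first by move=> _; exact: h.
by apply: h; rewrite mem_enum.
Qed.

Lemma eq_definable_subst (I J : finType) (s : I -> sig_sort S)
    (t : J -> sig_sort S) (th : forall i, term A t (s i))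
    (X : set (basic_set A s)) :
  eq_definable X -> eq_definable [set a | X (fun i => eval a (th i))].
Proof.
move=> [E hE]; exists (map (atomic_subst th) E) => a /=; rewrite hE.
by elim: E {hE} => //= p E IH; rewrite /solves /= -!/(solves _ _) IH holds_subst.
Qed.

Lemma e_definable_eq (I : finType) (s : I -> sig_sort S)
    (X : set (basic_set A s)) : eq_definable X -> e_definable X.
Proof.
(* No unknowns are added, so their index type is [void]; [th] only renames the variables into the
   left summand. *)
move=> hX; pose t (j : void) : sig_sort S := match j with end.
pose th i : term A (cat_sorts s t) (s i) := TVar A (cat_sorts s t) (inl i).
have [E hE] := eq_definable_subst th hX.
exists void, t, E => a; split=> [Xa|[y /hE //]].
by exists (fun j : void => match j with end); apply/hE.
Qed.

(** Functions on tuples that are values of terms. Definability proofs can then handle ordinary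
    expressions in [N] and [M] instead of syntax. *)
Definition term_fun (I : finType) (s : I -> sig_sort S) u
    (F : basic_set A s -> A u) : Prop :=
  exists p : term A s u, forall a, eval a p = F a.

Lemma term_fun_const (I : finType) (s : I -> sig_sort S) u (c : A u) :
  term_fun (fun _ : basic_set A s => c).
Proof. by exists (TConst s c). Qed.

Lemma eq_definable_term (I : finType) (s : I -> sig_sort S) u
    (F G : basic_set A s -> A u) :
  term_fun F -> term_fun G -> eq_definable [set a | F a = G a].
Proof.
move=> [p hp] [q hq]; exists [:: AEq p q] => a.
by rewrite /solves /= hp hq; split=> [|[]].
Qed.

End EquationDefinable.

(** * Definability of preimages under an interpretation *)

Section PreimageDefinable.
Variables (S T : signature) (A : structure S) (B : structure T).
Variables (I : sig_sort S -> finType) (s : forall u, I u -> sig_sort T).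
Variables (X : forall u, set (basic_set B (s (u := u)))).
Variable phi : forall u, {x | X (u := u) x} -> A u.

(** The equations [Q] need to describe [P] only on tuples from the domains; the domain conditions
    are definable themselves and are added as further equations. *)
Lemma tuple_preimage_definable (K : finType) (r : K -> sig_sort S)
    (P : set (basic_set A r)) :
  (forall u, eq_definable (X (u := u))) ->
  (exists2 Q : set (basic_set B (preimage_sorts s (r := r))), eq_definable Q &
   forall x (hx : forall k, X (fun i => x (existT (fun k => I (r k)) k i))),
     P (fun k => phi (exist _ _ (hx k))) <-> Q x) ->
  e_definable (tuple_preimage phi P).
Proof.
move=> dX [Q dQ PQ]; apply: e_definable_eq.
pose Y k : set (basic_set B (preimage_sorts s (r := r))) :=
  [set x | X (fun i => x (existT (fun k => I (r k)) k i))].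
have dY : eq_definable ([set x | forall k, Y k x] `&` Q).
  apply: eq_definableI dQ; apply: eq_definable_forall => k.
  pose th i : term B (preimage_sorts s (r := r)) (s i) :=
    TVar B (preimage_sorts s (r := r)) (existT (fun k => I (r k)) k i).
  exact: (eq_definable_subst th (dX (r k))).
apply: eq_definable_ext dY => x; split=> [[hx Px]|[hx Qx]].
  by split=> //; apply/(PQ _ hx).
by exists hx; apply/(PQ _ hx).
Qed.

End PreimageDefinable.

(** * Submodules, generators and linear extension *)

Section Submodules.
Variable L : comPzRingType.

Definition submodule (V : lmodType L) (W : set V) : Prop :=
  [/\ W 0, forall x y, W x -> W y -> W (x + y) & forall c x, W x -> W (c *: x)].

Lemma submodule_sum (V : lmodType L) (W : set V) (I : Type) (r : seq I)
    (P : pred I) (F : I -> V) :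
  submodule W -> (forall i, W (F i)) -> W (\sum_(i <- r | P i) F i).
Proof. by move=> [W0 WD WZ] hF; elim/big_ind: _. Qed.

Lemma lspan_min (V : lmodType L) (G W : set V) :
  submodule W -> G `<=` W -> lspan G `<=` W.
Proof.
move=> sW GW _ [m [c [g [hg ->]]]]; apply: submodule_sum => // i.
by case: sW => _ _; apply; exact: GW.
Qed.

Lemma sub_lspan (V : lmodType L) (G : set V) : G `<=` lspan G.
Proof.
move=> x Gx; exists 1%N, (fun=> 1), (fun=> x); split=> //.
by rewrite big_ord1 scale1r.
Qed.

Lemma lspan_submodule (V : lmodType L) (G : set V) : submodule (lspan G).
Proof.
split=> [|_ _ [m [c [g [hg ->]]]] [m' [c' [g' [hg' ->]]]]|a _ [m [c [g [hg ->]]]]].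
- exists 0%N, (fun=> 0), (fun=> 0); rewrite big_ord0; split=> // - [] //.
- exists (m + m')%N.
  exists (fun i => match split i with inl j => c j | inr j => c' j end).
  exists (fun i => match split i with inl j => g j | inr j => g' j end).
  split=> [i|]; first by case: split.
  rewrite big_split_ord /=; congr (_ + _); apply: eq_bigr => i _.
    case: splitP => [j /= /ord_inj ->//|j /= h].
    by have := ltn_ord i; rewrite h ltnNge leq_addr.
  case: splitP => [j /= h|j /eqP]; last by rewrite eqn_add2l => /eqP/ord_inj ->.
  by have := ltn_ord j; rewrite -h ltnNge leq_addr.
- exists m, (fun i => a * c i), g; split=> //.
  by rewrite scaler_sumr; apply: eq_bigr => i _; rewrite scalerA.
Qed.

Lemma lspan_mono (V : lmodType L) (G H : set V) :
  G `<=` H -> lspan G `<=` lspan H.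
Proof.
move=> GH; apply: lspan_min; first exact: lspan_submodule.
by move=> x /GH; exact: sub_lspan.
Qed.

(** An [lspan] combination may have any length and repeat generators; collecting terms leaves one
    coefficient per position of the list. *)
Lemma lspan_seqP (V : lmodType L) (s : seq V) v :
  lspan [set x | x \in s] v -> exists c : 'I_(size s) -> L, v = \sum_i c i *: s`_i.
Proof.
pose W : set V := [set v | exists c : 'I_(size s) -> L, v = \sum_i c i *: s`_i].
apply: (@lspan_min _ _ W) v.
  split=> [|_ _ [c ->] [d ->]|a _ [c ->]].
  - by exists (fun=> 0); rewrite big1 // => i _; rewrite scale0r.
  - exists (fun i => c i + d i); rewrite -big_split.
    by apply: eq_bigr => i _; rewrite scalerDl.
  - exists (fun i => a * c i).
    by rewrite scaler_sumr; apply: eq_bigr => i _; rewrite scalerA.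
move=> x /= xs; have si : (index x s < size s)%N by rewrite index_mem.
exists (fun i => (i == Ordinal si)%:R); rewrite (bigD1 (Ordinal si)) //= eqxx.
rewrite scale1r nth_index // big1 ?addr0 // => i /negbTE ->.
by rewrite scale0r.
Qed.

Lemma lspan_cons (V : lmodType L) (x : V) (s : seq V) v :
  lspan [set y | y \in x :: s] v ->
  exists c w, lspan [set y | y \in s] w /\ v = c *: x + w.
Proof.
have [S0 SD SZ] := lspan_submodule [set y | y \in s].
pose W : set V := [set v | exists c w, lspan [set y | y \in s] w /\ v = c *: x + w].
apply: (@lspan_min _ _ W) v.
  split=> [|_ _ [c [w [hw ->]]] [d [w' [hw' ->]]]|a _ [c [w [hw ->]]]].
  - by exists 0, 0; rewrite scale0r addr0.
  - by exists (c + d), (w + w'); rewrite scalerDl addrACA; split=> //; exact: SD.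
  - by exists (a * c), (a *: w); rewrite scalerDr scalerA; split=> //; exact: SZ.
move=> y /=; rewrite inE => /predU1P[->|ys].
  by exists 1, 0; rewrite scale1r addr0.
by exists 0, y; rewrite scale0r add0r; split=> //; exact: sub_lspan.
Qed.

(* Induction on the number of generators of the ambient module: the coefficients
   along the first generator form an ideal. *)
Lemma noetherian_submodule (V : lmodType L) (s : seq V) (W : set V) :
  noetherian L -> submodule W -> W `<=` lspan [set x | x \in s] ->
  exists r : seq V, lspan [set x | x \in r] = W.
Proof.
move=> nL; elim: s W => [|x s IH] W sW Ws.
  exists [::]; apply/seteqP; split; first exact: lspan_min.
  exact: Ws.
have [W0 WD WZ] := sW; have [S0 SD SZ] := lspan_submodule [set y | y \in s].
(* The elements of [W] in the span of the remaining generators are handled by induction. *)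
have [r' hr'] : exists r : seq V,
    lspan [set y | y \in r] = W `&` lspan [set y | y \in s].
  apply: IH => [|y []//]; split=> //.
    by move=> y z [? ?] [? ?]; split; [exact: WD|exact: SD].
  by move=> c y [? ?]; split; [exact: WZ|exact: SZ].
pose a : set L := [set c | exists w, lspan [set y | y \in s] w /\ W (c *: x + w)].
have [|ca hca] := nL a.
  split; first by exists 0; rewrite scale0r addr0.
    move=> c d [w [hw Ww]] [w' [hw' Ww']]; exists (w + w').
    by rewrite scalerDl addrACA; split; [exact: SD|exact: WD].
  move=> b c [w [hw Ww]]; exists (b *: w).
  by rewrite -scalerA -scalerDr; split; [exact: SZ|exact: WZ].
(* Each generator [c] of the ideal is lifted to an element of [W] with coefficient [c] along [x];
   outside [ca] the value is irrelevant and set to 0. *)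
have [|g hg] := @choice _ _ (fun c w => c \in ca ->
    W w /\ lspan [set y | y \in s] (w - c *: x)).
  move=> c.
  have [cca|] := boolP (c \in ca); last by exists 0.
  have [w [hw Ww]] : a c by rewrite -hca; exact: sub_lspan.
  by exists (c *: x + w) => _; rewrite addrAC subrr add0r.
exists (map g ca ++ r'); apply/seteqP; split.
  apply: lspan_min => // y /=; rewrite mem_cat => /orP[/mapP[c /hg [? _] ->]//|yr].
  suff [] : (W `&` lspan [set y | y \in s]) y by [].
  by rewrite -hr'; exact: sub_lspan.
move=> v Wv; have [c [w [hw vE]]] := lspan_cons (Ws _ Wv).
have : a c by exists w; rewrite -vE.
rewrite -hca => /lspan_seqP[d cE].
(* This combination of lifts has the same coefficient along [x] as [v], so [v - z] belongs to [W]
   and to the span of [s], hence to the span of [r']. *)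
pose z := \sum_i d i *: g ca`_i.
have gP (i : 'I_(size ca)) := hg _ (mem_nth 0 (ltn_ord i)).
have hz : lspan [set y | y \in map g ca ++ r'] z.
  apply: submodule_sum => [|i]; first exact: lspan_submodule.
  have [_ _] := lspan_submodule [set y | y \in map g ca ++ r']; apply.
  by apply: sub_lspan; rewrite /= mem_cat map_f // mem_nth.
have Wz : W z by apply: submodule_sum => // i; apply: WZ; case: (gP i).
rewrite -(subrKC z v); have [_ RD _] := lspan_submodule [set y | y \in map g ca ++ r'].
apply: RD => //; apply: (@lspan_mono _ [set y | y \in r']).
  by move=> y /= yr; rewrite mem_cat yr orbT.
rewrite hr'; split; first by apply: WD => //; rewrite -scaleN1r; exact: WZ.
rewrite vE [c *: x + w]addrC -addrA; apply: (SD) => //.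
have -> : c *: x - z = \sum_i (- d i) *: (g ca`_i - ca`_i *: x).
  rewrite cE scaler_suml -sumrB; apply: eq_bigr => i _.
  by rewrite scaleNr scalerBr opprB scalerA.
by apply: submodule_sum => // i; apply: (SZ); case: (gP i).
Qed.

Definition generates (V : lmodType L) (I : finType) (g : I -> V) : Prop :=
  forall v, exists c : I -> L, v = \sum_i c i *: g i.

Lemma generates_lspan (V : lmodType L) (G : set V) (I : finType) (g : I -> V) :
  lspan G = setT -> (forall v, G v -> exists c : I -> L, v = \sum_i c i *: g i) ->
  generates g.
Proof.
move=> GT hG v; have : lspan G v by rewrite GT.
pose W : set V := [set v | exists c : I -> L, v = \sum_i c i *: g i].
apply: (@lspan_min _ _ W) v => //; split=> [|_ _ [c ->] [d ->]|a _ [c ->]].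
- by exists (fun=> 0); rewrite big1 // => i _; rewrite scale0r.
- exists (fun i => c i + d i); rewrite -big_split.
  by apply: eq_bigr => i _; rewrite scalerDl.
- exists (fun i => a * c i).
  by rewrite scaler_sumr; apply: eq_bigr => i _; rewrite scalerA.
Qed.

Lemma finitely_generatedP (V : lmodType L) :
  finitely_generated V -> exists k (g : 'I_k -> V), generates g.
Proof.
move=> [s hs]; exists (size s), (fun i => s`_i) => v.
by apply: lspan_seqP; rewrite hs.
Qed.

Lemma eq_linear_generates (V U : lmodType L) (I : finType) (g : I -> V)
    (a b : {linear V -> U}) :
  generates g -> (forall i, a (g i) = b (g i)) -> a = b.
Proof.
move=> hg ab; apply: linear_ext => v; have [c ->] := hg v.
by rewrite !linear_sum; apply: eq_bigr => i _; rewrite !linearZ ab.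
Qed.

(** The map is defined through chosen coefficients. Two expansions of one vector differ by a
    relation among the generators, so the hypothesis makes the value independent of the choice, and
    linearity follows. *)
Lemma linear_extension (V U : lmodType L) (I : finType) (g : I -> V) (h : I -> U) :
  generates g ->
  (forall c : I -> L, \sum_i c i *: g i = 0 -> \sum_i c i *: h i = 0) ->
  exists a : {linear V -> U}, forall i, a (g i) = h i.
Proof.
move=> hg rel; have [co hco] := choice hg.
pose a v := \sum_i co v i *: h i.
have aE v (c : I -> L) : v = \sum_i c i *: g i -> a v = \sum_i c i *: h i.
  move=> vE; apply/eqP; rewrite -subr_eq0 -sumrB; apply/eqP.
  under eq_bigr do rewrite -scalerBl.
  apply: (rel (fun i => co v i - c i)).
  under eq_bigr do rewrite scalerBl.
  by rewrite sumrB -hco -vE subrr.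
have la : linear a.
  move=> b v w; rewrite (aE (b *: v + w) (fun i => b * co v i + co w i)).
    rewrite /a scaler_sumr -big_split; apply: eq_bigr => i _ /=.
    by rewrite scalerDl scalerA.
  rewrite {1}[v]hco {1}[w]hco scaler_sumr -big_split; apply: eq_bigr => i _ /=.
  by rewrite scalerDl scalerA.
pose ca := GRing.isLinear.Build L V U *:%R a la.
pose al : {linear V -> U} := HB.pack a ca.
exists al => i; rewrite /= (aE _ (fun j => (j == i)%:R)).
  rewrite (bigD1 i) //= eqxx scale1r big1 ?addr0 // => j /negbTE ->.
  by rewrite scale0r.
rewrite (bigD1 i) //= eqxx scale1r big1 ?addr0 // => j /negbTE ->.
by rewrite scale0r.
Qed.

(** The finitely many matrix units span the whole matrix module, so [noetherian_submodule]
    applies. *)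
Lemma noetherian_matrix (m n : nat) (W : set 'M[L]_(m, n)) :
  noetherian L -> submodule W ->
  exists r : seq 'M[L]_(m, n), lspan [set x | x \in r] = W.
Proof.
move=> nL sW.
pose s := [seq delta_mx p.1 p.2 : 'M[L]_(m, n) | p <- enum {: 'I_m * 'I_n}].
apply: (@noetherian_submodule _ s) => // C _.
have sS := lspan_submodule [set x | x \in s].
rewrite [C]matrix_sum_delta; do 2![apply: submodule_sum => // ?].
case: sS => _ _; apply; apply: sub_lspan.
by apply: (map_f (fun p => delta_mx p.1 p.2) (mem_enum _ (_, _))).
Qed.

End Submodules.

(** Supplies the abstract ring that [ring_of_scalars] asks for. Elements of the subtype are equal
    once they agree pointwise, so the ring axioms are inherited from endomorphisms. *)
Lemma commutative_subalgebra_ring (L : comPzRingType) (V : lmodType L)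
    (R : set {linear V -> V}) :
  is_subalgebra R -> (forall a b, R a -> R b -> a \o b =1 b \o a) ->
  exists (D : comPzRingType) (h : D -> {linear V -> V}),
    ring_embedding h /\ R = range h.
Proof.
move=> [S1 SD SM SZ] RC.
pose D := {a | R a}.
pose eD : hasDecEq D := gen_eqMixin D.
pose cD : hasChoice D := gen_choiceMixin D.
have Deq (u v : D) : (forall x, sval u x = sval v x) -> u = v.
  by case: u v => u hu [v hv] uv; apply: eq_exist; exact: linear_ext.
(* Zero and, below, opposites are obtained by scaling with 0 and -1. *)
have S0 : R \0.
  have -> : \0 = 0 \*: idfun :> {linear V -> V}.
    by apply: linear_ext => x /=; rewrite scale0r.
  exact: SZ.
pose z : D := exist _ _ S0.
pose o : D := exist _ _ S1.
pose ad (u v : D) : D := exist _ _ (SD _ _ (svalP u) (svalP v)).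
pose mu (u v : D) : D := exist _ _ (SM _ _ (svalP u) (svalP v)).
pose op (u : D) : D := exist _ _ (SZ (-1) _ (svalP u)).
have adA : associative ad by move=> u v w; apply: Deq => x /=; rewrite addrA.
have adC : commutative ad by move=> u v; apply: Deq => x /=; rewrite addrC.
have ad0 : left_id z ad by move=> u; apply: Deq => x /=; rewrite add0r.
have adN : left_inverse z op ad.
  by move=> u; apply: Deq => x /=; rewrite scaleN1r addNr.
have muA : associative mu by move=> u v w; apply: Deq.
have muC : commutative mu by move=> u v; apply: Deq; apply: RC; exact: svalP.
have mu1 : left_id o mu by move=> u; apply: Deq.
have muD : left_distributive mu ad by move=> u v w; apply: Deq.
pose cT : choiceType := HB.pack D eD cD.
pose zD := GRing.isZmodule.Build cT adA adC ad0 adN.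
pose zT : zmodType := HB.pack D cT zD.
pose rD := GRing.Zmodule_isComPzRing.Build zT muA muC mu1 muD.
pose rT : comPzRingType := HB.pack D zT rD.
exists rT, (fun u : rT => sval (u : D)); split.
  by split=> // u v uv; apply: Deq => x; rewrite uv.
apply/seteqP; split=> [a Ra|_ [u _ <-]]; last exact: svalP.
by exists (exist _ a Ra).
Qed.

(** * Terms and equations in the two-sorted structure of a bilinear map *)

Section Bimap.
Variables (L : comPzRingType) (N M : lmodType L) (f : N -> N -> M).
Hypothesis bf : is_bilinear f.

Lemma bilin_suml I (r : seq I) P (F : I -> N) y :
  f (\sum_(i <- r | P i) F i) y = \sum_(i <- r | P i) f (F i) y.
Proof.
by apply: (big_morph (f^~ y)) => [x x'|]; [exact: bilin_Dl|exact: bilin_0l].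
Qed.

Lemma bilin_sumr I (r : seq I) P (F : I -> N) x :
  f x (\sum_(i <- r | P i) F i) = \sum_(i <- r | P i) f x (F i).
Proof. by apply: (big_morph (f x)) => [y y'|]; [exact: bilin_Dr|exact: bilin_0r]. Qed.

Section Terms.
Variables (I : finType) (s : I -> bimap_sort).
Notation B := (bimap_structure f).

Lemma term_fun_add u (F G : basic_set B s -> bimap_carrier N M u) :
  term_fun (A := B) (u := u) F -> term_fun (A := B) (u := u) G ->
  term_fun (A := B) (u := u) (fun a => F a + G a).
Proof.
move=> [p hp] [q hq].
exists (@TApp (bimap_signature L) B I s (ModAdd u)
  (fun j => if j == ord0 then p else q)) => a /=.
by rewrite hp hq.
Qed.

Lemma term_fun_scale u c (F : basic_set B s -> bimap_carrier N M u) :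
  term_fun (A := B) (u := u) F -> term_fun (A := B) (u := u) (fun a => c *: F a).
Proof.
move=> [p hp].
exists (@TApp (bimap_signature L) B I s (ModScale u c) (fun j => p)) => a /=.
by rewrite hp.
Qed.

(** Subtraction is not a symbol of the language; it is addition after scaling by -1. *)
Lemma term_fun_sub u (F G : basic_set B s -> bimap_carrier N M u) :
  term_fun (A := B) (u := u) F -> term_fun (A := B) (u := u) G ->
  term_fun (A := B) (u := u) (fun a => F a - G a).
Proof.
move=> hF /(term_fun_scale (-1)) hG; have [p hp] := term_fun_add hF hG.
by exists p => a; rewrite hp scaleN1r.
Qed.

Lemma term_fun_sum u (J : finType) (F : J -> basic_set B s -> bimap_carrier N M u) :
  (forall j, term_fun (A := B) (u := u) (F j)) ->
  term_fun (A := B) (u := u) (fun a => \sum_j F j a).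
Proof.
move=> hF; elim: (index_enum J) => [|j r [p hp]].
  by exists (@TConst _ B _ s u (0 : bimap_carrier N M u)) => a; rewrite big_nil.
have [|q hq] := term_fun_add (hF j) (G := fun a => \sum_(j <- r) F j a).
  by exists p.
by exists q => a; rewrite big_cons hq.
Qed.

Lemma term_fun_app (F G : basic_set B s -> N) :
  term_fun (A := B) (u := SortN) F -> term_fun (A := B) (u := SortN) G ->
  term_fun (A := B) (u := SortM) (fun a => f (F a) (G a)).
Proof.
move=> [p hp] [q hq].
exists (@TApp (bimap_signature L) B I s BimapApp
  (fun j => if j == ord0 then p else q)) => a /=.
by rewrite hp hq.
Qed.

(** For fixed [a], the matrices [C] with [F C a = 0] form a submodule. The equations for a finite
    generating list of [W] therefore imply those for all of [W]. *)
Lemma eq_definable_submodule u (m n : nat) (W : set 'M[L]_(m, n))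
    (F : 'M[L]_(m, n) -> basic_set B s -> bimap_carrier N M u) :
  noetherian L -> submodule W -> (forall a, linear (F^~ a)) ->
  (forall C, term_fun (A := B) (u := u) (F C)) ->
  eq_definable (A := B) [set a | forall C, W C -> F C a = 0].
Proof.
move=> nL sW lF tF; have [r hr] := noetherian_matrix nL sW.
have dF : eq_definable (A := B) [set a | forall C, C \in r -> F C a = 0].
  apply: (@eq_definable_seq _ B _ _ _ r (fun C => [set a | F C a = 0])) => C _.
  exact: (@eq_definable_term _ B _ _ u _ _ (tF C) (@term_fun_const _ B _ _ u 0)).
apply: eq_definable_ext dF => a; split=> h C.
  by move=> Cr; apply: h; rewrite -hr; exact: sub_lspan.
have F0 : F 0 a = 0.
  by have := lF a (-1) 0 0; rewrite /= scaler0 addr0 scaleN1r addNr.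
rewrite -hr; apply: (@lspan_min _ _ _ [set D | F D a = 0]) => //; split=> // [x y|c x] /=.
  by move=> x0 y0; have := lF a 1 x y; rewrite /= !scale1r => ->; rewrite x0 y0 addr0.
by move=> x0; have := lF a c x 0; rewrite /= addr0 => ->; rewrite x0 F0 scaler0 addr0.
Qed.

End Terms.

Hypothesis nf : bimap_nondegenerate f.

(** * Endomorphisms as tuples of values on generators *)

Section Generators.
Variables (k : nat) (n : 'I_k -> N).
Hypothesis gn : generates n.
Notation B := (bimap_structure f).
Notation sorts := (fun _ : 'I_k => SortN).

(** Linearity in the second argument reduces nondegeneracy to testing on generators, so an equality
    in [N] becomes finitely many equalities in [M]. *)
Lemma nondegenerate_generates z z' :
  (forall j, f z (n j) = f z' (n j)) -> z = z'.
Proof.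
move=> h; apply/eqP; rewrite -subr_eq0; apply/eqP; apply: nf.1 => x.
have [c ->] := gn x; rewrite bilin_sumr big1 // => i _.
by rewrite bilin_Zr // bilin_Bl // h subrr scaler0.
Qed.

Lemma Sym_generates (a : {linear N -> N}) :
  (forall i j, f (a (n i)) (n j) = f (n i) (a (n j))) -> Sym f a.
Proof.
move=> h x y; have [c ->] := gn x; have [d ->] := gn y.
rewrite !linear_sum !bilin_suml; apply: eq_bigr => i _.
rewrite !bilin_sumr; apply: eq_bigr => j _.
by rewrite !linearZ !bilin_Zl // !bilin_Zr // h.
Qed.

(* Nondegeneracy forces a tuple satisfying the symmetry equations to respect
   the relations between the generators. *)
Lemma Sym_extension (a : 'I_k -> N) :
  (forall i j, f (a i) (n j) = f (n i) (a j)) ->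
  exists2 al : {linear N -> N}, Sym f al & forall i, al (n i) = a i.
Proof.
move=> h; have [|al hal] := linear_extension (h := a) gn.
  move=> c c0; apply: nondegenerate_generates => j.
  rewrite bilin_0l // bilin_suml.
  (* The symmetry equations shift [a] to the second argument, where the relation can be applied to
     the generators themselves. *)
  transitivity (f (\sum_i c i *: n i) (a j)); last by rewrite c0 bilin_0l.
  by rewrite bilin_suml; apply: eq_bigr => i _; rewrite !bilin_Zl // h.
by exists al => //; apply: Sym_generates => i j; rewrite !hal.
Qed.

Definition value_tuples (R : set {linear N -> N}) : set (basic_set B sorts) :=
  [set a | exists2 al : {linear N -> N}, R al & forall i, al (n i) = a i].

Definition Sym_equations : set (basic_set B sorts) :=
  [set a | forall i j, f (a i) (n j) = f (n i) (a j)].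

Lemma term_fun_var i :
  term_fun (A := B) (u := SortN) (fun a : basic_set B sorts => a i).
Proof. by exists (TVar B sorts i). Qed.

Lemma Sym_equations_definable : eq_definable Sym_equations.
Proof.
do 2![apply: eq_definable_forall => ?].
by apply: (@eq_definable_term _ B _ _ SortM);
  apply: term_fun_app; (exact: term_fun_var || exact: (@term_fun_const _ B _ _ SortN)).
Qed.

(** Common to both algebras: what remains for each is the definability of its tuples. Symmetry of
    the members of [R] is what makes multiplication expressible. *)
Lemma subalgebra_interpretable (R : set {linear N -> N}) (hR : is_subalgebra R) :
  R `<=` Sym f -> eq_definable (value_tuples R) ->
  e_interpretable (subalgebra_structure hR) B.
Proof.
move=> RS dR.
(* The endomorphism is picked by choice, but its values on generators determine it, which gives
   [phi_eq]. *)
pose phi (u : unit) (x : {a | value_tuples R a}) : {a | R a} :=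
  let: exist2 al Ral _ := cid2 (svalP x) in exist _ al Ral.
have phiE u x i : sval (phi u x) (n i) = sval x i.
  by rewrite /phi; case: (cid2 _).
have phi_eq u (al : {a | R a}) x : phi u x = al <-> forall i, sval x i = sval al (n i).
  split=> [<- i|h]; first by rewrite phiE.
  case: al h => al Ral h; case E: (phi u x) => [be Rbe].
  apply: eq_exist; apply: (eq_linear_generates gn) => i.
  by rewrite -h -(phiE u) E.
exists (fun=> 'I_k), (fun _ => sorts), (fun=> value_tuples R), phi; split.
- by move=> u; apply: e_definable_eq.
- move=> u [al Ral].
  have X : value_tuples R (fun i => al (n i)) by exists al.
  by exists (exist _ _ X); apply/phi_eq.
- move=> u.
  apply: tuple_preimage_definable => //; exists
    [set x | forall i, x (existT (fun=> 'I_k) true i) = x (existT (fun=> 'I_k) false i)].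
    apply: eq_definable_forall => i.
    by apply: (@eq_definable_term _ B _ _ SortN); eexists (TVar _ _ _).
  move=> x hx; rewrite /equality_graph /= phi_eq /=.
  by split=> h i; rewrite ?phiE h ?phiE.
- case=> [||c].
  + apply: tuple_preimage_definable => //; exists
      [set x | forall i, (x (existT (fun=> 'I_k) None i) : N) =
        x (existT (fun=> 'I_k) (Some ord0) i) + x (existT (fun=> 'I_k) (Some ord_max) i)].
      apply: eq_definable_forall => i.
      apply: (@eq_definable_term _ B _ _ SortN); first by eexists (TVar _ _ _).
      by apply: (@term_fun_add _ _ SortN); eexists (TVar _ _ _).
    move=> x hx; rewrite /function_graph /=.
    split=> [/esym/phi_eq h i|h]; first by rewrite [LHS]h /= !phiE.
    by apply/esym/phi_eq => i; rewrite [LHS]h /= !phiE.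
  + apply: tuple_preimage_definable => //; exists
      [set x | forall i j, f (x (existT (fun=> 'I_k) None i)) (n j) =
        f (x (existT (fun=> 'I_k) (Some ord_max) i)) (x (existT (fun=> 'I_k) (Some ord0) j))].
      do 2![apply: eq_definable_forall => ?].
      apply: (@eq_definable_term _ B _ _ SortM); apply: term_fun_app;
        by [exact: (@term_fun_const _ B _ _ SortN) | eexists (TVar _ _ _)].
    move=> x hx; rewrite /function_graph /=.
    (* Index [Some ord0] is the left factor, applied last. Its symmetry moves it to the second
       argument, so the values of both factors on generators suffice; nondegeneracy then recovers
       the product. *)
    have key (al be : {a | R a}) i j :
        f (sval al (sval be (n i))) (n j) = f (sval be (n i)) (sval al (n j)).
      exact: RS (svalP al) _ _.
    split=> [/esym/phi_eq h i j|h]; first by rewrite [X in f X]h /= key !phiE.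
    apply/esym/phi_eq => i; apply: nondegenerate_generates => j.
    by rewrite [LHS]h /= key !phiE.
  + apply: tuple_preimage_definable => //; exists
      [set x | forall i, (x (existT (fun=> 'I_k) None i) : N) =
        c *: (x (existT (fun=> 'I_k) (Some ord0) i) : N)].
      apply: eq_definable_forall => i.
      apply: (@eq_definable_term _ B _ _ SortN); first by eexists (TVar _ _ _).
      by apply: (@term_fun_scale _ _ SortN); eexists (TVar _ _ _).
    move=> x hx; rewrite /function_graph /=.
    split=> [/esym/phi_eq h i|h]; first by rewrite [LHS]h /= !phiE.
    by apply/esym/phi_eq => i; rewrite [LHS]h /= !phiE.
- by case.
Qed.

Lemma ZSym_definable : noetherian L -> eq_definable (value_tuples (ZSym f)).
Proof.
move=> nL.
(* All matrices of symmetric endomorphisms: since the generators may satisfy relations, one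
   endomorphism can have several matrices, and a matrix need not define any. *)
pose W : set 'M[L]_k := [set C | exists2 b : {linear N -> N}, Sym f b &
  forall i, b (n i) = \sum_j C i j *: n j].
have sW : submodule W.
  split=> [|C D [b sb hb] [d sd hd]|c C [b sb hb]].
  - exists \0 => [x y|i] /=; first by rewrite bilin_0l // bilin_0r.
    by rewrite big1 // => j _; rewrite mxE scale0r.
  - exists (b \+ d) => [x y|i] /=; first by rewrite bilin_Dl // bilin_Dr // sb sd.
    by rewrite hb hd -big_split; apply: eq_bigr => j _; rewrite mxE scalerDl.
  - exists (c \*: b) => [x y|i] /=; first by rewrite bilin_Zl // bilin_Zr // sb.
    by rewrite hb scaler_sumr; apply: eq_bigr => j _; rewrite mxE scalerA.
(* If [C] is a matrix of [b], this is the commutator ab - ba at n_i, paired with n_l. In the second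
   sum [b] is moved to the other argument by symmetry, so that only values of [a] on generators
   occur. *)
pose F i l (C : 'M[L]_k) (a : basic_set B sorts) : M :=
  \sum_j C i j *: f (a j) (n l) - \sum_j C l j *: f (a i) (n j).
have dF : eq_definable (A := B)
    [set a | forall i l C, W C -> F i l C a = 0].
  do 2![apply: eq_definable_forall => ?].
  apply: (@eq_definable_submodule _ _ SortM) => // [a c C D|C].
    rewrite /F scalerBr !scaler_sumr addrACA -opprD -!big_split /=.
    by congr (_ - _); apply: eq_bigr => j _; rewrite !mxE scalerDl scalerA.
  by apply: (@term_fun_sub _ _ SortM); apply: (@term_fun_sum _ _ SortM) => j;
    apply: (@term_fun_scale _ _ SortM); apply: term_fun_app;
    (exact: term_fun_var || exact: (@term_fun_const _ B _ _ SortN)).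
have FE i l (C : 'M[L]_k) (al b : {linear N -> N}) (a : basic_set B sorts) :
    Sym f b -> (forall i, b (n i) = \sum_j C i j *: n j) ->
    (forall i, al (n i) = a i) ->
    F i l C a = f (al (b (n i))) (n l) - f (b (al (n i))) (n l).
  move=> sb hb ha; rewrite sb !hb linear_sum bilin_suml bilin_sumr.
  by congr (_ - _); apply: eq_bigr => j _;
    rewrite ?linearZ /= ?bilin_Zl // ?bilin_Zr // ?ha.
apply: eq_definable_ext (eq_definableI Sym_equations_definable dF) => a.
split=> [[al [sal cal] ha]|[ea wa]].
  split=> [i j|i l C [b sb hb]]; first by rewrite -!ha sal.
  by rewrite (FE _ _ _ _ _ _ sb hb ha) [al _](cal b sb) subrr.
have [al sal ha] := Sym_extension ea; exists al => //; split=> // b sb.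
suff E : al \o b = b \o al :> {linear N -> N} 
  by move=> x; move/(congr1 (fun g : {linear N -> N} => g x)): E.
apply: (eq_linear_generates gn) => i; apply: nondegenerate_generates => l /=.
have [C hC] := choice (fun i => gn (b (n i))).
have hb i' : b (n i') = \sum_j (\matrix_(i, j) C i j) i' j *: n j.
  by rewrite {1}hC; apply: eq_bigr => j _; rewrite mxE.
by apply/eqP; rewrite -subr_eq0 -(FE _ _ _ _ _ _ sb hb ha) wa //; exists b.
Qed.

(** An explicit form of [R(f)]: the endomorphisms of [N] with a compatible endomorphism of [M]. The
    identification is [largest_ring_of_scalarsE]. *)
Definition scalars : set {linear N -> N} :=
  [set a | exists b : {linear M -> M},
    forall x y, f (a x) y = f x (a y) /\ f x (a y) = b (f x y)].

Hypothesis ff : bimap_full f.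

(** Fullness leaves only values of [f] to expand, which bilinearity does. On these generators of [M]
    the action of a scalar is prescribed by its action on [N]. *)
Lemma bimap_generates : generates (fun p : 'I_k * 'I_k => f (n p.1) (n p.2)).
Proof.
apply: generates_lspan ff _ => _ [x [y ->]].
have [c ->] := gn x; have [d ->] := gn y.
exists (fun p => c p.1 * d p.2).
rewrite bilin_suml -(pair_bigA _ (fun i j => (c i * d j) *: f (n i) (n j))) /=.
apply: eq_bigr => i _; rewrite bilin_sumr; apply: eq_bigr => j _.
by rewrite bilin_Zl // bilin_Zr // scalerA.
Qed.

Lemma scalars_definable : noetherian L -> eq_definable (value_tuples scalars).
Proof.
move=> nL.
pose F (C : 'M[L]_k) (a : basic_set B sorts) : M :=
  \sum_i \sum_j C i j *: f (n i) (a j).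
have lF a : linear (F^~ a).
  move=> c C D; rewrite /F scaler_sumr -big_split; apply: eq_bigr => i _ /=.
  rewrite scaler_sumr -big_split; apply: eq_bigr => j _ /=.
  by rewrite !mxE scalerDl scalerA.
(* With the generators as the tuple, [F] evaluates [C] on the products f(n_i, n_j), so [W] is their
   module of relations. *)
pose W : set 'M[L]_k := [set C | F C n = 0].
have sW : submodule W.
  have F0 : F 0 n = 0.
    by have := lF n (-1) 0 0; rewrite /= scaler0 addr0 scaleN1r addNr.
  split=> // [C D C0 D0|c C C0]; rewrite /W /=.
    by have := lF n 1 C D; rewrite /= !scale1r => ->; rewrite C0 D0 addr0.
  by have := lF n c C 0; rewrite /= !addr0 => ->; rewrite C0 F0 scaler0 addr0.
have dF : eq_definable (A := B) [set a | forall C, W C -> F C a = 0].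
  apply: (@eq_definable_submodule _ _ SortM) => // C.
  by do 2![apply: (@term_fun_sum _ _ SortM) => ?];
    apply: (@term_fun_scale _ _ SortM); apply: term_fun_app;
    (exact: term_fun_var || exact: (@term_fun_const _ B _ _ SortN)).
apply: eq_definable_ext (eq_definableI Sym_equations_definable dF) => a.
split=> [[al [b hb] ha]|[ea wa]].
  split=> [i j|C C0]; first by rewrite -!ha (hb _ _).1.
  transitivity (b (F C n)); last by rewrite C0 linear0.
  rewrite /F linear_sum; apply: eq_bigr => i _.
  by rewrite linear_sum; apply: eq_bigr => j _; rewrite linearZ -ha (hb _ _).2.
have [al sal ha] := Sym_extension ea; exists al => //.
(* By [wa] every relation among the f(n_i, n_j) also holds among the f(n_i, a_j), so sending the
   former to the latter extends to [M]. *)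
have [|b hb] := linear_extension
    (h := fun p : 'I_k * 'I_k => f (n p.1) (a p.2)) bimap_generates.
  move=> c; have pairE (h : 'I_k -> N) :
      \sum_(p : 'I_k * 'I_k) c p *: f (n p.1) (h p.2) =
      \sum_i \sum_j c (i, j) *: f (n i) (h j).
    by rewrite pair_bigA; apply: eq_bigr => -[].
  rewrite !pairE => c0.
  rewrite -[RHS](wa (\matrix_(i, j) c (i, j))).
    by do 2![apply: eq_bigr => ? _]; rewrite mxE.
  rewrite /W /= -c0.
  by do 2![apply: eq_bigr => ? _]; rewrite mxE.
exists b => x y; split; first exact: sal.
have [c ->] := gn x; have [d ->] := gn y.
rewrite linear_sum !bilin_suml linear_sum; apply: eq_bigr => i _.
rewrite !bilin_sumr linear_sum; apply: eq_bigr => j _.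
have /= hbij := hb (i, j).
rewrite linearZ !bilin_Zl // !bilin_Zr // !linearZ /= ha hbij.
by rewrite !scalerA mulrC.
Qed.

End Generators.

(** * Identification of the largest ring of scalars *)

Hypothesis ff : bimap_full f.

Lemma scalars_subalgebra : is_subalgebra scalars.
Proof.
split.
- by exists idfun.
- move=> a a' [b h] [b' h']; exists (b \+ b') => x y /=.
  rewrite bilin_Dl // bilin_Dr //.
  by rewrite (h x y).1 (h' x y).1 (h x y).2 (h' x y).2.
- move=> a a' [b h] [b' h']; exists (b \o b') => x y /=.
  rewrite (h _ y).1 (h _ y).2 (h' x y).1 (h' x y).2.
  by rewrite (h x (a' y)).2 (h' x y).2.
- move=> c a [b h]; exists (c \*: b) => x y /=.
  by rewrite bilin_Zl // bilin_Zr // (h x y).1 (h x y).2.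
Qed.

(** Both f(aa'x, y) and f(a'ax, y) equal b'(f(x, ay)), where b' is the action of a' on [M];
    nondegeneracy cancels [y]. *)
Lemma scalars_comm a a' : scalars a -> scalars a' -> a \o a' =1 a' \o a.
Proof.
move=> [b h] [b' h'] x; apply/eqP; rewrite -subr_eq0; apply/eqP; apply: nf.1 => y.
apply/eqP; rewrite bilin_Bl // subr_eq0; apply/eqP => /=.
rewrite (h _ y).1 (h' x (a y)).1.
by rewrite (h' x (a y)).2 (h' _ y).1 (h' _ y).2 (h x y).1.
Qed.

Lemma scalars_ring : ring_of_scalars f scalars.
Proof.
have [D [h [eh hE]]] :=
  commutative_subalgebra_ring scalars_subalgebra scalars_comm.
have sh u : scalars (h u) by rewrite hE; exists u.
have [hM hMP] := choice sh.
(* By fullness the chosen actions on [M] are unique, which forces them to respect sums, products and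
   1. *)
have gM (b b' : {linear M -> M}) : (forall x y, b (f x y) = b' (f x y)) -> b = b'.
  move=> bb'; apply: linear_ext => m.
  have : lspan [set m | exists x y, m = f x y] m by rewrite ff.
  move=> [i [c [g [gf ->]]]]; rewrite !linear_sum; apply: eq_bigr => j _.
  by rewrite !linearZ; have [x [y ->]] := gf j; rewrite bb'.
exists D, h, hM; split=> //; split.
(* Faithfulness on [M]: the action on [M] determines all values f(ax, y), hence [a] by
   nondegeneracy. *)
- move=> u v uv; apply: (ring_embedding_inj eh); apply: linear_ext => x.
  apply/eqP; rewrite -subr_eq0; apply/eqP; apply: nf.1 => y.
  by rewrite bilin_Bl // !(hMP _ _ _).1 !(hMP _ _ _).2 uv subrr.
- move=> u v m; suff -> : hM (u + v) = (hM u \+ hM v) :> {linear M -> M} by [].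
  by apply: gM => x y /=; rewrite -!(hMP _ x y).2 (ring_embeddingD eh) bilin_Dr.
- move=> u v m; suff -> : hM (u * v) = (hM u \o hM v) :> {linear M -> M} by [].
  apply: gM => x y /=; rewrite -!(hMP _ x y).2 (ring_embeddingM eh) /=.
  by rewrite -!(hMP _ _ _).2.
- move=> m; suff -> : hM 1 = idfun by [].
  by apply: gM => x y; rewrite -(hMP _ x y).2 (ring_embedding1 eh).
Qed.

(** Any ring of scalars lies in [scalars] through its own action on [M]; conversely [scalars] is one
    of the rings that [R] must contain. *)
Lemma largest_ring_of_scalarsE (R : set {linear N -> N}) :
  largest_ring_of_scalars f R -> R = scalars.
Proof.
move=> [[D [hN [hM [_ _ h RE]]]] mR]; apply/seteqP; split.
  by rewrite RE => _ [u _ <-]; exists (hM u); exact: h.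
exact: mR scalars_ring.
Qed.

End Bimap.

Theorem theorem1p9 (L : comPzRingType) (N M : lmodType L) (f : N -> N -> M)
    (noethL : noetherian L)
    (fgN : finitely_generated N) (fgM : finitely_generated M)
    (bf : is_bilinear f) (ff : bimap_full f) (nf : bimap_nondegenerate f) :
  e_interpretable (subalgebra_structure (ZSym_subalgebra bf))
    (bimap_structure f) /\
  (forall (R : set {linear N -> N}) (lR : largest_ring_of_scalars f R),
    e_interpretable
      (subalgebra_structure
        (largest_ring_of_scalars_subalgebra bf ff nf lR))
      (bimap_structure f)).
Proof.
have [k [n gn]] := finitely_generatedP fgN.
split=> [|R lR]; apply: (subalgebra_interpretable bf nf gn).
- by move=> a [].
- exact: ZSym_definable.
- by rewrite (largest_ring_of_scalarsE bf nf ff lR) => a [b h] x y; case: (h x y).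
- rewrite (largest_ring_of_scalarsE bf nf ff lR).
  exact: scalars_definable.
Qed.
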